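(* Let $C_{(\geq,\geq)}(x,y)$ be the bivariate generating function of the Catalan words avoiding the ordered pair of relations $(\geq,\geq)$, where $x$ marks the length and $y$ marks the number of descents. Then $$C_{(\geq,\geq)}(x,y)=\frac{1 - x - x^2 + x^2 y - \sqrt{(1 - x - x^2 (1 + y))^2 - 4 x^3 (1 + x) y}}{2 x^2 y}.$$
   Context: A Catalan word of length $n$ is a word $w=w_1w_2\cdots w_n$ over the non-negative integers with $w_1=0$ and $0\leq w_i\leq w_{i-1}+1$ for $i=2,\dots,n$; the empty word is the unique Catalan word of length $0$. For relations $X,Y\in\{<,>,\leq,\geq,=,\neq\}$, a word $w$ contains the pattern $(X,Y)$ if there is an index $i\geq 1$ (with $i+2\le n$) such that $w_i\,X\,w_{i+1}$ and $w_{i+1}\,Y\,w_{i+2}$; otherwise $w$ avoids $(X,Y)$. The number of descents $\mathrm{des}(w)$ is the number of indices $i$ with $w_i>w_{i+1}$. The bivariate generating function is $C_{(X,Y)}(x,y)=\sum_{w}x^{|w|}y^{\mathrm{des}(w)}$, the sum being over all Catalan words $w$ (of any length $|w|\geq 0$) avoiding $(X,Y)$. Identities are between formal power series in $x$ with coefficients polynomials in $y$ (after clearing denominators); the square root of a power series with constant term $1$ is the one with constant term $1$. *)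

(* Defs.v *)
From HB Require Import structures.
From mathcomp Require Import all_boot all_order all_algebra.
From mathcomp Require Import boolp.

Set Implicit Arguments.
Unset Strict Implicit.
Unset Printing Implicit Defensive.

Import GRing.Theory Num.Theory.
Local Open Scope ring_scope.

Record fps (R : Type) := FPS { fcoef : nat -> R }.

HB.instance Definition _ (R : Type) := gen_eqMixin (fps R).
HB.instance Definition _ (R : Type) := gen_choiceMixin (fps R).

Lemma fpsP (R : Type) (a b : fps R) :
  (forall n, fcoef a n = fcoef b n) -> a = b.
Proof. by case: a b => [a] [b] /= /funext ->. Qed.

Section FpsRing.
Variable R : comNzRingType.
Implicit Types a b c : fps R.

Definition fpsC (c : R) : fps R := FPS (fun n => if n == 0%N then c else 0).
Definition fpsX : fps R := FPS (fun n => (n == 1%N)%:R).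

Definition fps_add a b := FPS (fun n => fcoef a n + fcoef b n).
Definition fps_opp a := FPS (fun n => - fcoef a n).
Definition fps_mul a b :=
  FPS (fun n => \sum_(i < n.+1) fcoef a i * fcoef b (n - i)).

Fact fps_addA : associative fps_add.
Proof. by move=> a b c; apply: fpsP => n /=; rewrite addrA. Qed.
Fact fps_addC : commutative fps_add.
Proof. by move=> a b; apply: fpsP => n /=; rewrite addrC. Qed.
Fact fps_add0 : left_id (fpsC 0) fps_add.
Proof. by move=> a; apply: fpsP => n /=; case: ifP; rewrite add0r. Qed.
Fact fps_addN : left_inverse (fpsC 0) fps_opp fps_add.
Proof. by move=> a; apply: fpsP => n /=; case: ifP; rewrite addNr. Qed.

HB.instance Definition _ :=
  GRing.isZmodule.Build (fps R) fps_addA fps_addC fps_add0 fps_addN.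

Let trunc n a : {poly R} := \poly_(i < n.+1) fcoef a i.

Let fps_mul_trunc n k a b : (k <= n)%N ->
  fcoef (fps_mul a b) k = (trunc n a * trunc n b)`_k.
Proof.
move=> le_kn; rewrite coefM /=; apply: eq_bigr => i _.
have le_ik : (i <= k)%N by rewrite -ltnS.
by rewrite !coef_poly !ltnS (leq_trans le_ik le_kn) (leq_trans (leq_subr _ _)).
Qed.

Fact fps_mulA : associative fps_mul.
Proof.
move=> a b c; apply: fpsP => n.
have -> : fcoef (fps_mul a (fps_mul b c)) n
          = (trunc n a * (trunc n b * trunc n c))`_n.
  rewrite coefM /=; apply: eq_bigr => i _.
  by rewrite coef_poly ltn_ord -(fps_mul_trunc _ _ (leq_subr _ _)).
rewrite mulrA coefM /=; apply: eq_bigr => i _.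
by rewrite -fps_mul_trunc -1?ltnS // coef_poly ltnS leq_subr.
Qed.
Fact fps_mulC : commutative fps_mul.
Proof.
move=> a b; apply: fpsP => n.
by rewrite !(fps_mul_trunc _ _ (leqnn n)) mulrC.
Qed.
Fact fps_mul1 : left_id (fpsC 1) fps_mul.
Proof.
move=> a; apply: fpsP => n /=.
by rewrite big_ord_recl /= mul1r subn0 big1 ?addr0 // => i _; rewrite mul0r.
Qed.
Fact fps_mulDl : left_distributive fps_mul fps_add.
Proof.
move=> a b c; apply: fpsP => n /=.
by rewrite -big_split; apply: eq_bigr => i _; rewrite mulrDl.
Qed.
Fact fps_oner_neq0 : fpsC 1 != 0.
Proof.
apply/eqP => /(congr1 (fun a => fcoef a 0%N)) /= /eqP.
by rewrite oner_eq0.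
Qed.

HB.instance Definition _ :=
  GRing.Zmodule_isComNzRing.Build (fps R)
    fps_mulA fps_mulC fps_mul1 fps_mulDl fps_oner_neq0.

Lemma fcoefD a b n : fcoef (a + b) n = fcoef a n + fcoef b n.
Proof. by []. Qed.
Lemma fcoefN a n : fcoef (- a) n = - fcoef a n.
Proof. by []. Qed.
Lemma fcoefM a b n :
  fcoef (a * b) n = \sum_(i < n.+1) fcoef a i * fcoef b (n - i).
Proof. by []. Qed.
Lemma fcoefC (c : R) n : fcoef (fpsC c) n = if n == 0%N then c else 0.
Proof. by []. Qed.
Lemma fcoefX n : fcoef fpsX n = (n == 1%N)%:R :> R.
Proof. by []. Qed.

End FpsRing.

Arguments fpsX {R}.

Section FpsSqrt.
Variable R : comUnitRingType.
Implicit Types a s t : fps R.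

(* Comparing coefficients in s ^+ 2 = a with s_0 = 1 gives
   2 s_n = a_n - (s_1 s_(n-1) + ... + s_(n-1) s_1) for n > 0. *)
Fixpoint sqrt_seq a n : seq R :=
  if n is m.+1 then
    let s := sqrt_seq a m in
    rcons s ((fcoef a n - \sum_(1 <= k < n) s`_k * s`_(n - k)) / 2%:R)
  else [:: 1].

Definition fps_sqrt a : fps R := FPS (fun n => (sqrt_seq a n)`_n).

Lemma fcoef_fps_sqrt0 a : fcoef (fps_sqrt a) 0%N = 1.
Proof. by []. Qed.

Let size_sqrt_seq a n : size (sqrt_seq a n) = n.+1.
Proof. by elim: n => //= n IHn; rewrite size_rcons IHn. Qed.

Let nth_sqrt_seq a n k : (k <= n)%N ->
  (sqrt_seq a n)`_k = fcoef (fps_sqrt a) k.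
Proof.
elim: n => [|n IHn]; first by rewrite leqn0 => /eqP->.
rewrite leq_eqVlt => /predU1P[-> //|lt_kn].
by rewrite /= nth_rcons size_sqrt_seq lt_kn IHn.
Qed.

Let coef_sqr s n : fcoef s 0%N = 1 -> (0 < n)%N ->
  fcoef (s ^+ 2) n
  = fcoef s n *+ 2 + \sum_(1 <= k < n) fcoef s k * fcoef s (n - k).
Proof.
case: n => // n s0 _; rewrite expr2 fcoefM.
rewrite -(big_mkord xpredT (fun i => fcoef s i * fcoef s (n.+1 - i))).
rewrite big_nat_recr //= big_ltn // subnn subn0 s0 mul1r mulr1.
by rewrite addrAC mulr2n.
Qed.

Lemma sqr_fps_sqrt a : (2%:R : R) \is a GRing.unit -> fcoef a 0%N = 1 ->
  fps_sqrt a ^+ 2 = a.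
Proof.
move=> u2 a0; apply: fpsP => -[|n].
  by rewrite expr2 fcoefM big_ord1 /= mulr1 a0.
rewrite coef_sqr // {1}/fps_sqrt /= nth_rcons size_sqrt_seq ltnn eqxx.
rewrite -[X in X + _]mulr_natr divrK //.
rewrite (@eq_big_nat _ _ _ _ _ _
  (fun k => fcoef (fps_sqrt a) k * fcoef (fps_sqrt a) (n.+1 - k))).
  exact: subrK.
by case=> // k /= le_kn; rewrite !nth_sqrt_seq // subSS leq_subr.
Qed.

Lemma fps_sqrt_unique a s : (2%:R : R) \is a GRing.unit ->
  s ^+ 2 = a -> fcoef s 0%N = 1 -> s = fps_sqrt a.
Proof.
move=> u2 sa s0.
have a0 : fcoef a 0%N = 1 by rewrite -sa expr2 fcoefM big_ord1 /= s0 mulr1.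
apply: fpsP; elim/ltn_ind => -[//|n] IHn.
have /(congr1 (fun b => fcoef b n.+1)) : s ^+ 2 = fps_sqrt a ^+ 2.
  by rewrite sqr_fps_sqrt.
rewrite !coef_sqr //.
rewrite (@eq_big_nat _ _ _ _ _ _
  (fun k => fcoef (fps_sqrt a) k * fcoef (fps_sqrt a) (n.+1 - k))).
  by move/addIr; rewrite -!(mulr_natr (fcoef _ _)); apply: mulIr.
by case=> // k /= le_kn; rewrite !IHn // subSS ltnS leq_subr.
Qed.

End FpsSqrt.

Lemma poly_rat_unit2 : (2%:R : {poly rat}) \is a GRing.unit.
Proof.
by rewrite -polyC_natr poly_unitE size_polyC coefC eqxx unitfE pnatr_eq0.
Qed.

(* Positions are 0-based. *)
Definition catalan_word (w : seq nat) : bool :=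
  (nth 0 w 0 == 0)%N &&
  all (fun i => nth 0 w i.+1 <= (nth 0 w i).+1)%N (iota 0 (size w).-1).

Definition contains (X Y : rel nat) (w : seq nat) : bool :=
  has (fun i => X (nth 0 w i) (nth 0 w i.+1) &&
                Y (nth 0 w i.+1) (nth 0 w i.+2))%N
      (iota 0 (size w - 2)).

Definition avoids (X Y : rel nat) (w : seq nat) : bool := ~~ contains X Y w.

Definition des (w : seq nat) : nat :=
  count (fun i => nth 0 w i > nth 0 w i.+1)%N (iota 0 (size w).-1).

Lemma catalan_word_nth_leq w i : catalan_word w -> (i < size w)%N ->
  (nth 0 w i <= i)%N.
Proof.
case/andP=> /eqP w0 /allP w_step.
elim: i => [_|i IHi lt_iw]; first by rewrite w0.
apply: leq_trans (w_step i _) _; last by rewrite ltnS IHi // ltnW.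
by rewrite mem_iota /= add0n; case: (size w) lt_iw.
Qed.

(* The coefficient of x^n in C_(X,Y)(x,y), with y rendered as the polynomial
   variable 'X.  By [catalan_word_nth_leq] the letters of a Catalan word of
   length n are < n, so that the Catalan words of length n are all found among
   the tuples over 'I_n. *)
Definition catalan_coef (X Y : rel nat) (n : nat) : {poly rat} :=
  \sum_(w : n.-tuple 'I_n | catalan_word (map val w) && avoids X Y (map val w))
    'X^(des (map val w)).

Definition catalan_gf (X Y : rel nat) : fps {poly rat} :=
  FPS (catalan_coef X Y).

(* Main.v *)
Require Import Defs.
From mathcomp Require Import all_boot all_order all_algebra.
From mathcomp Require Import ring zify.

Set Implicit Arguments.
Unset Strict Implicit.
Unset Printing Implicit Defensive.

Import GRing.Theory.
Local Open Scope ring_scope.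

(** Let [B h] be the generating function of the words that may follow a rise,
    each preceded by the letter [h] reached by this rise, together with the
    empty word; [B 0] is the required series [C].  After a weak descent the
    only legal letter is the rise, so reading words from left to right gives
      [B h = 1 + x (1 + x) B (h + 1) + x^2 y (B 1 + ... + B h)].
    With [r = 1 + x^2 y B 1], the differences [B (h + 1) - r B h] satisfy the
    homogeneous version of this system, which has only the zero solution.
    Hence [B 1 = r B 0], and eliminating [B 1] with the equation for [B 0] gives
    [C = 1 + x (1 + x) C + x^2 y C (C - 1)]; completing the square concludes. *)

Section FpsCoef.
Variable R : comNzRingType.
Implicit Types a : fps R.

Lemma fcoefXM a n : fcoef (fpsX * a) n = if n is k.+1 then fcoef a k else 0.
Proof.
rewrite fcoefM big_ord_recl fcoefX mul0r add0r; case: n => [|n].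
  by rewrite big_ord0.
rewrite big_ord_recl /= mul1r subSS subn0 big1 ?addr0 // => i _.
by rewrite mul0r.
Qed.

Lemma fcoefCM (c : R) a n : fcoef (fpsC c * a) n = c * fcoef a n.
Proof.
by rewrite fcoefM big_ord_recl /= subn0 big1 ?addr0 // => i _; rewrite mul0r.
Qed.

Lemma fcoef_sum (I : Type) (s : seq I) (F : I -> fps R) n :
  fcoef (\sum_(i <- s) F i) n = \sum_(i <- s) fcoef (F i) n.
Proof.
apply: (big_morph (fun a => fcoef a n)) => // /=.
by case: ifP.
Qed.

(** Every [E] on the right carries a factor [fpsX], so each coefficient depends only on lower ones;
    the induction on [n] treats all [h] at once. *)
Lemma fps_system_eq0 (c : R) (E : nat -> fps R) :
    (forall h, E h = fpsX * (E h.+1 + fpsX * (E h.+1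
                        + fpsC c * \sum_(j < h) E j.+1))) ->
  forall h, E h = 0.
Proof.
move=> E_eq h; apply: fpsP => n; have -> : fcoef (0 : fps R) n = 0.
  by case: n.
elim/ltn_ind: n h => -[|n] IHn h; rewrite E_eq fcoefXM //.
rewrite fcoefD IHn // add0r fcoefXM; case: n IHn => // n IHn.
rewrite fcoefD IHn // add0r fcoefCM fcoef_sum big1 ?mulr0 // => i _.
exact: IHn.
Qed.

Lemma fps_system_quadratic (c : R) (B : nat -> fps R) :
    (forall h, B h = 1 + fpsX * (B h.+1 + fpsX * (B h.+1
                        + fpsC c * \sum_(j < h) B j.+1))) ->
  B 0%N = 1 + fpsX * (1 + fpsX) * B 0%N
          + fpsX ^+ 2 * fpsC c * B 0%N * (B 0%N - 1).
Proof.
move=> B_eq; pose r := 1 + fpsX ^+ 2 * fpsC c * B 1%N.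
have B_geom : forall h, B h.+1 - r * B h = 0.
  apply: (@fps_system_eq0 c) => h.
  rewrite {1}(B_eq h.+1) {1}(B_eq h) sumrB -mulr_sumr.
  (* The split-off term [j = 0] contributes [r - 1], which cancels the constant [1 - r]. *)
  rewrite big_ord_recl /= /r.
  have -> : \sum_(i < h) B (bump 0 i).+1 = \sum_(i < h) B i.+2 by [].
  move: (\sum_(i < h) B i.+2) (\sum_(i < h) B i.+1) => S S'.
  by ring.
have /eqP := B_geom 0%N; rewrite subr_eq0 /r => /eqP B1.
have B0 : B 0%N = 1 + fpsX * (1 + fpsX) * B 1%N.
  by rewrite {1}B_eq big_ord0; ring.
have xB1 : fpsX * (1 + fpsX) * B 1%N = B 0%N - 1 by rewrite B0; ring.
rewrite {1}B0 {1}B1 -xB1; ring.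
Qed.

End FpsCoef.

Lemma des_cons2 a b s : des (a :: b :: s) = ((b < a) + des (b :: s))%N.
Proof. by rewrite /des /= -[1%N]/(1 + 0)%N iotaDl count_map. Qed.

Lemma contains_cons3 X Y a b c s :
  contains X Y (a :: b :: c :: s) = X a b && Y b c || contains X Y (b :: c :: s).
Proof. by rewrite /contains /= !subn2 /= -[1%N]/(1 + 0)%N iotaDl has_map. Qed.

Lemma catalan_wordE a s :
  catalan_word (a :: s) = (a == 0)%N && path (fun i j => j <= i.+1)%N a s.
Proof.
rewrite /catalan_word /=; congr (_ && _).
elim: s a => //= b s IHs a.
by rewrite -IHs -[1%N]/(1 + 0)%N iotaDl all_map.
Qed.

(* [wt f h s] is the weight of the word [s] read after the letter [h], where
   [f] tells whether [h] was reached by a weak descent. *)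
Fixpoint wt (f : bool) (h : nat) (s : seq nat) : {poly rat} :=
  if s is a :: s' then
    if (a <= h.+1)%N && ~~ (f && (a <= h)%N)
    then 'X^(a < h)%N * wt (a <= h)%N a s' else 0
  else 1.

(** Of [p] only the comparison with [h] matters; a descent from [p] to [h] is not counted here but
    at the step that reads [h]. *)
Lemma wt_avoids p h s :
  wt (h <= p)%N h s =
    if path (fun i j => j <= i.+1)%N h s && avoids geq geq (p :: h :: s)
    then 'X^(des (h :: s)) else 0.
Proof.
elim: s p h => [|a s IHs] p h //=.
rewrite IHs /avoids contains_cons3 negb_or des_cons2 exprD.
case: (a <= h.+1)%N => //=.
case: ((h <= p) && (a <= h))%N => /=; first by rewrite andbF.
by case: ifP => //; rewrite mulr0.
Qed.

(** No pattern can begin before the initial 0, so it acts as a letter reached by a rise. *)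
Lemma wt_catalan s :
  wt false 0 s =
    if catalan_word (0%N :: s) && avoids geq geq (0%N :: s)
    then 'X^(des (0%N :: s)) else 0.
Proof.
rewrite catalan_wordE eqxx; case: s => [|a s] //=.
rewrite wt_avoids andbT des_cons2 mul1r add0n.
by case: (a <= 1)%N.
Qed.

(** The total of [wt f h] over words of length [n], split by first letter: [h.+1], [h], then
    [j < h]. *)
Fixpoint ext_weight (n : nat) (f : bool) (h : nat) : {poly rat} :=
  if n is k.+1 then
    ext_weight k false h.+1 +
    (if f then 0
     else ext_weight k true h + 'X * \sum_(j < h) ext_weight k true j)
  else 1.

Lemma big_tuple_cons (V : nmodType) (T : finType) n (F : seq T -> V) :
  \sum_(t : n.+1.-tuple T) F t = \sum_(a : T) \sum_(t : n.-tuple T) F (a :: t).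
Proof.
rewrite pair_big /=.
rewrite (reindex (fun p : T * n.-tuple T => [tuple of p.1 :: p.2])) //=.
exists (fun t => (thead t, [tuple of behead t])) => [[a t]|t] _ /=.
  by congr pair; apply: val_inj.
by rewrite -tuple_eta.
Qed.

(** Letters grow by at most 1 per step, so [h + n < m] ensures that the alphabet ['I_m] misses
    none. *)
Lemma sum_wt m n f h : (h + n < m)%N ->
  \sum_(t : n.-tuple 'I_m) wt f h (map val t) = ext_weight n f h.
Proof.
elim: n f h => [|n IHn] f h lt_m.
  rewrite (eq_bigr (fun=> 1)) => [|t _]; last by rewrite tuple0.
  by rewrite sumr_const card_tuple expn0.
rewrite (big_tuple_cons n (fun t => wt f h (map val t))) /=.
pose g a : {poly rat} := if (a <= h.+1)%N && ~~ (f && (a <= h)%N)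
  then 'X^(a < h)%N * ext_weight n (a <= h)%N a else 0.
transitivity (\sum_(a < m) g a).
  apply: eq_bigr => a _; rewrite /g.
  case: ifP => [/andP[le_a _]|_]; last by rewrite big1.
  by rewrite -mulr_sumr IHn //; lia.
(* Letters above [h.+1] have weight 0; then [h.+1] and [h] are peeled off, leaving the descents. *)
rewrite -(big_mkord xpredT g) (@big_cat_nat _ _ _ h.+2) //=; last by lia.
rewrite [X in _ + X]big1_seq ?addr0 => [|a]; last first.
  by rewrite mem_index_iota /g => /= /andP[lt_a _]; rewrite leqNgt lt_a.
rewrite big_nat_recr //= addrC {1}/g leqnn ltnn !andbF /=.
rewrite ltnNge leqnSn mul1r; congr (_ + _).
rewrite big_nat_recr //= {2}/g leqnn leqnSn ltnn andbT mul1r addrC.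
case: f @g => g /=.
  rewrite add0r big1_seq // => a; rewrite mem_index_iota /g => /= lt_a.
  by rewrite (ltnW lt_a) andbF.
congr (_ + _); rewrite big_mkord mulr_sumr; apply: eq_bigr => a _.
have le_ah : (a <= h)%N := ltnW (ltn_ord a).
by rewrite /g ltn_ord le_ah leqW.
Qed.

(** The series [B h]: the shift by one counts the letter [h] in front. *)
Definition height_gf (h : nat) : fps {poly rat} :=
  FPS (fun n => if n is k.+1 then ext_weight k false h else 1).

Lemma height_gf_eq h :
  height_gf h = 1 + fpsX * (height_gf h.+1 + fpsX * (height_gf h.+1
                      + fpsC 'X * \sum_(j < h) height_gf j.+1)).
Proof.
(* After a weak descent to [j], the next letter, if any, is [j.+1]. *)
have weight_true k j : ext_weight k true j = fcoef (height_gf j.+1) k.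
  by case: k => //= k; rewrite addr0.
apply: fpsP => n; rewrite fcoefD fcoefXM; case: n => [|n].
  by rewrite addr0.
rewrite fcoefD fcoefXM add0r; case: n => [|n]; first by rewrite addr0.
rewrite fcoefD fcoefCM fcoef_sum -!weight_true [ext_weight n.+1 true h]addr0.
congr (_ + (_ + 'X * _)).
by apply: eq_bigr => j _; exact: weight_true.
Qed.

Lemma catalan_gf_height : catalan_gf geq geq = height_gf 0.
Proof.
apply: fpsP => -[|n]; rewrite /= /catalan_coef.
  rewrite (eq_bigl xpredT) => [|t]; last by rewrite tuple0.
  rewrite (eq_bigr (fun=> 1)) => [|t _]; last by rewrite tuple0.
  by rewrite sumr_const card_tuple.
rewrite big_mkcond /=.
rewrite (big_tuple_cons n (fun t : seq 'I_n.+1 => let w := map val t in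
  if catalan_word w && avoids geq geq w then 'X^(des w) else 0 : {poly rat})).
rewrite big_ord_recl [X in _ + X]big1 ?addr0 => [|i _]; last first.
  by rewrite big1.
rewrite -(@sum_wt n.+1) //; apply: eq_bigr => t _.
by rewrite wt_catalan.
Qed.

Theorem theorem3p13 :
  let x : fps {poly rat} := fpsX in
  let y : fps {poly rat} := fpsC 'X in
  2%:R * x ^+ 2 * y * catalan_gf geq geq =
    1 - x - x ^+ 2 + x ^+ 2 * y
    - fps_sqrt ((1 - x - x ^+ 2 * (1 + y)) ^+ 2
                - 4%:R * x ^+ 3 * (1 + x) * y).
Proof.
move=> x y; rewrite catalan_gf_height.
have C_eq := fps_system_quadratic height_gf_eq.
rewrite -/x -/y in C_eq; set C := height_gf 0 in C_eq *.
set D := (X in fps_sqrt X).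
suff <- : 1 - x - x ^+ 2 + x ^+ 2 * y - 2%:R * x ^+ 2 * y * C = fps_sqrt D.
  by ring.
apply: fps_sqrt_unique; first exact: poly_rat_unit2.
  (* [D] is the discriminant of the quadratic equation for [C]. *)
  have -> : D = (1 - x - x ^+ 2 + x ^+ 2 * y) ^+ 2 - 4%:R * x ^+ 2 * y.
    by rewrite /D; ring.
  (* The new factor equals 1 by [C_eq]. *)
  have -> : 4%:R * x ^+ 2 * y = 4%:R * x ^+ 2 * y
      * (C - (x * (1 + x) * C + x ^+ 2 * y * C * (C - 1))).
    by rewrite {1}C_eq; ring.
  ring.
have -> : 1 - x - x ^+ 2 + x ^+ 2 * y - 2%:R * x ^+ 2 * y * C
    = 1 + x * (x * y - 1 - x - 2%:R * x * y * C) by ring.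
by rewrite fcoefD fcoefXM addr0.
Qed.
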